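(* Let $X=(X_1,\dots,X_n):\Omega\to\mathbb{R}^n$ be a discrete uncertain variable, let $f:[\![X]\!]\to\mathbb{R}^q$ be a query and $\mathfrak{M}:\mathbb{R}^q\to\mathbb{R}^q$ a mapping such that the mechanism $\mathfrak{M}\circ f$ is $\epsilon$-noiselessly private, $\epsilon>0$. Let $i\in\{1,\dots,n\}$ and $\psi_{i,v_{-i}}\in\Psi_i$ (that is, $v_{-i}\in[\![X_{-i}]\!]$) be arbitrary, and set $Y=\mathfrak{M}\circ f\circ\psi_{i,v_{-i}}\circ X$. Then $$0\le I_\star(X_i;Y)\le L_0^{\mathrm{s}}(X_i;Y)\le L_0(Y;X_i)\le \epsilon .$$
   Context: Uncertain variables. Let $\Omega$ be a nonempty set (no measure is assumed). An uncertain variable is a map $X:\Omega\to\mathbb{X}$. Its range is $[\![X]\!]=\{X(\omega):\omega\in\Omega\}$. For uncertain variables $X,Y$ and $y\in[\![Y]\!]$, the conditional range is $[\![X|y]\!]=\{X(\omega):\omega\in\Omega,\ Y(\omega)=y\}$, also written $[\![X|Y(\omega)=y]\!]$. $X$ is discrete if $[\![X]\!]$ is countable. Datasets and privacy. $X=(X_1,\dots,X_n)$ is a dataset, $X_i:\Omega\to\mathbb{R}$ being the data of individual $i$; $x_{-i}$ and $X_{-i}$ denote the vectors with the $i$-th entry removed. $\mathfrak{M}\circ f$ is $\epsilon$-noiselessly private if, with $Z=\mathfrak{M}\circ f\circ X$, $|[\![Z|X_{-i}(\omega)=x_{-i}]\!]|\le 2^\epsilon$ for all $i$ and all $x_{-i}\in[\![X_{-i}]\!]$.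 The maps $\psi$. For $v_{-i}\in[\![X_{-i}]\!]$, $\psi_{i,v_{-i}}:[\![X]\!]\to[\![X_i]\!]\times\{v_{-i}\}$ is the map $\psi_{i,v_{-i}}(x)=(v_1,\dots,v_{i-1},x_i,v_{i+1},\dots,v_n)$, and $\Psi_i=\{\psi_{i,v_{-i}}: v_{-i}\in[\![X_{-i}]\!]\}$. It is understood that $[\![X]\!]$ contains every vector with $i$-th entry in $[\![X_i]\!]$ and remaining entries $v_{-i}\in[\![X_{-i}]\!]$, so that $f\circ\psi_{i,v_{-i}}$ is defined. Information measures, for discrete uncertain variables $A,B$. Non-stochastic information leakage: $L_0(A;B)=\max_{b\in[\![B]\!]}\log_2\left(|[\![A]\!]|/|[\![A|b]\!]|\right)$ (maximum read as supremum if necessary; the quantity is considered when the ratios are well defined, i.e. not $\infty/\infty$). Symmetrized leakage: $L_0^{\mathrm{s}}(A;B)=\min(L_0(A;B),L_0(B;A))$. Maximin information: two points $a,a'\in[\![A]\!]$ are $[\![A|B]\!]$-overlap connected if there is a finite sequence $b_1,\dots,b_m\in[\![B]\!]$ with $a\in[\![A|b_1]\!]$, $a'\in[\![A|b_m]\!]$ and $[\![A|b_j]\!]\cap[\![A|b_{j+1}]\!]\ne\emptyset$ for $j=1,\dots,m-1$. This is an equivalence relation on $[\![A]\!]$; $[\![A|B]\!]_\star$ denotes the partition of $[\![A]\!]$ into its equivalence classes, and $I_\star(A;B)=\log_2|[\![A|B]\!]_\star|$. *)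

(* Defs.v *)
From HB Require Import structures.
From mathcomp Require Import all_boot all_order all_algebra.
From mathcomp Require Import all_classical all_reals all_analysis.

Set Implicit Arguments.
Unset Strict Implicit.
Unset Printing Implicit Defensive.

Import Order.TTheory GRing.Theory Num.Theory.

Local Open Scope classical_set_scope.
Local Open Scope ring_scope.
Local Open Scope ereal_scope.

(* An uncertain variable is a plain function [A : Omega -> T]; its range is
   [range A]. *)

(* [[A | b]], the values of [A] compatible with [B = b]. *)
Definition cond_range (Omega T U : Type) (A : Omega -> T) (B : Omega -> U)
    (b : U) : set T :=
  A @` [set w | B w = b].

Definition discrete (Omega T : Type) (A : Omega -> T) : Prop :=
  countable (range A).

Definition log2 (R : realType) (x : \bar R) : \bar R :=
  lne x * ((ln 2)^-1)%:E.

(* No ratio |[[A]]| / |[[A | b]]| is of the form oo / oo. *)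
Definition leakage_defined (Omega T U : Type) (A : Omega -> T)
    (B : Omega -> U) : Prop :=
  forall b, range B b -> finite_set (range A) \/ finite_set (cond_range A B b).

(* [counting] is the cardinality of a set, with value [+oo] on infinite sets.
   Meaningful only under [leakage_defined A B], as [+oo / +oo = 0] in the
   library. *)
Definition leakage (R : realType) (Omega : Type) (T U : choiceType)
    (A : Omega -> T) (B : Omega -> U) : \bar R :=
  ereal_sup [set log2 (counting (range A) / counting (cond_range A B b))
            | b in range B].

Definition sym_leakage (R : realType) (Omega : Type) (T U : choiceType)
    (A : Omega -> T) (B : Omega -> U) : \bar R :=
  Order.min (leakage R A B) (leakage R B A).

(* The chain is indexed from 0: b 0, ..., b m. *)
Definition overlap_connected (Omega T U : Type) (A : Omega -> T)
    (B : Omega -> U) (a a' : T) : Prop :=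
  exists (m : nat) (b : nat -> U),
    [/\ forall j, (j <= m)%N -> range B (b j),
        cond_range A B (b 0%N) a,
        cond_range A B (b m) a' &
        forall j, (j < m)%N ->
          cond_range A B (b j) `&` cond_range A B (b j.+1) !=set0].

Definition overlap_partition (Omega T U : Type) (A : Omega -> T)
    (B : Omega -> U) : set (set T) :=
  [set [set a' | range A a' /\ overlap_connected A B a a'] | a in range A].

Definition maximin_information (R : realType) (Omega T U : Type)
    (A : Omega -> T) (B : Omega -> U) : \bar R :=
  log2 (counting (overlap_partition A B)).

(* A dataset with [n] individuals is [X : Omega -> 'rV[R]_n]. *)

Definition data (R : realType) (Omega : Type) (n : nat)
    (X : Omega -> 'rV[R]_n) (i : 'I_n) : Omega -> R :=
  fun w => X w ord0 i.

Definition others (R : realType) (Omega : Type) (n : nat)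
    (X : Omega -> 'rV[R]_n) (i : 'I_n) : Omega -> 'rV[R]_n.-1 :=
  fun w => col' i (X w).

(* The vector with [i]-th entry [a] and remaining entries [v]. *)
Definition insert_entry (R : realType) (n : nat) (i : 'I_n) (a : R)
    (v : 'rV[R]_n.-1) : 'rV[R]_n :=
  \row_j (if unlift i j is Some k then v ord0 k else a).

Definition psi (R : realType) (n : nat) (i : 'I_n) (v : 'rV[R]_n.-1)
    (x : 'rV[R]_n) : 'rV[R]_n :=
  insert_entry i (x ord0 i) v.

(* Ensures that [psi i v] maps [range X] into [range X] for [v] in
   [range (others X i)], so that [f \o psi i v \o X] only evaluates [f] on
   [range X]. *)
Definition psi_compatible (R : realType) (Omega : Type) (n : nat)
    (X : Omega -> 'rV[R]_n) (i : 'I_n) : Prop :=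
  forall a v, range (data X i) a -> range (others X i) v ->
    range X (insert_entry i a v).

Definition noiselessly_private (R : realType) (Omega : Type) (n q : nat)
    (X : Omega -> 'rV[R]_n) (mech : 'rV[R]_n -> 'rV[R]_q) (eps : R) : Prop :=
  forall (i : 'I_n) (v : 'rV[R]_n.-1), range (others X i) v ->
    counting (cond_range (mech \o X) (others X i) v) <= (2 `^ eps)%:E.

(* Main.v *)
(* [Y] is a function of [Xi], so each [[Y | x]] is a singleton, the sets
   [[Xi | y]] are pairwise disjoint, and both [L_0(Y; Xi)] and [I_*(Xi; Y)]
   equal [log2 |[[Y]]|].  Every value of [Y] is attained by the mechanism
   conditionally on [X_{-i} = v], so privacy gives [|[[Y]]| <= 2^eps]; and
   some fiber of [Xi] over [Y] has at most the average size
   [|[[Xi]]| / |[[Y]]|], so [log2 |[[Y]]| <= L_0(Xi; Y)]. *)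
Require Import Defs.
From HB Require Import structures.
From mathcomp Require Import all_boot all_order all_algebra finmap.
From mathcomp Require Import all_classical all_reals all_analysis.

Set Implicit Arguments.
Unset Strict Implicit.
Unset Printing Implicit Defensive.

Import Order.TTheory GRing.Theory Num.Theory.

Local Open Scope classical_set_scope.
Local Open Scope ring_scope.
Local Open Scope ereal_scope.

Lemma le_log2 (R : realType) (x y : \bar R) :
  0 <= x -> x <= y -> log2 x <= log2 y.
Proof.
move=> x0 xy; apply: lee_wpmul2r.
  by rewrite lee_fin invr_ge0 ln_ge0// ler1n.
by rewrite lee_lne ?in_itv/= ?leey ?andbT// (le_trans x0).
Qed.

Lemma log2_ge0 (R : realType) (x : \bar R) : 1 <= x -> 0 <= log2 x.
Proof.
move=> x1; rewrite mule_ge0 ?lne_ge0//.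
by rewrite lee_fin invr_ge0 ln_ge0// ler1n.
Qed.

Lemma log2_powR (R : realType) (x : R) : log2 (2 `^ x)%:E = x%:E.
Proof.
rewrite /log2 lne_EFin ?powR_gt0// ln_powR -EFinM mulfK//.
by rewrite gt_eqF// ln_gt0// ltr1n.
Qed.

Lemma counting_finite (R : realType) (T : choiceType) (A : set T) :
  finite_set A -> counting A = (#|` fset_set A|%:R)%:E :> \bar R.
Proof. by move=> fA; rewrite /counting asboolT. Qed.

Lemma counting_infinite (R : realType) (T : choiceType) (A : set T) :
  infinite_set A -> counting A = +oo :> \bar R.
Proof. by move=> fA; rewrite /counting asboolF. Qed.

Lemma card_le_counting (R : realType) (T U : choiceType) (A : set T)
    (B : set U) : (A #<= B)%card -> counting A <= counting B :> \bar R.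
Proof.
move=> AB; have [fB|iB] := pselect (finite_set B); last first.
  by rewrite (counting_infinite _ iB) leey.
have fA := card_le_finite AB fB.
rewrite !counting_finite// lee_fin ler_nat.
have [n Bn] := fB; rewrite (card_fset_set Bn); apply: geq_card_fset_set.
by apply: (card_le_trans AB); have /card_eqPle[] := Bn.
Qed.

Lemma counting_set1 (R : realType) (T : choiceType) (a : T) :
  counting [set a] = 1 :> \bar R.
Proof. by rewrite counting_finite ?fset_set1 ?cardfs1. Qed.

Lemma counting_ge0 (R : realType) (T : choiceType) (A : set T) :
  0 <= counting A :> \bar R.
Proof. by rewrite /counting; case: ifPn => // _; rewrite lee_fin. Qed.

Lemma counting_ge1 (R : realType) (T : choiceType) (A : set T) :
  A !=set0 -> 1 <= counting A :> \bar R.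
Proof.
move=> [a Aa]; rewrite -(counting_set1 R a); apply: card_le_counting.
by apply: subset_card_le => _ ->.
Qed.

Lemma counting_lty_finite (R : realType) (T : choiceType) (A : set T) :
  (counting A < +oo :> \bar R) -> finite_set A.
Proof. by apply: contraPP => /(counting_infinite R) ->; rewrite ltxx. Qed.

(** The fibers of [g] over its attained values partition [A], so their sizes add up to that of
    [A]. *)
Lemma card_fibers (T U : choiceType) (g : T -> U) (A : set T) :
  finite_set A ->
  (\sum_(b <- fset_set (g @` A)) #|` fset_set (A `&` g @^-1` [set b])|
    = #|` fset_set A|)%N.
Proof.
move=> fA; rewrite fset_set_image//.
rewrite [RHS]card_fset_sum1 (partition_big_imfset _ g)/=.
apply: eq_bigr => b _; rewrite big_fset_condE/= -card_fset_sum1; congr #|` _|.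
apply/fsetP => x; rewrite in_fset_set; last exact: finite_setIl.
rewrite !inE/= in_fset_set// in_setI; congr (_ && _).
by apply/idP/eqP; rewrite inE.
Qed.

(** Averaging: the smallest of the fibers cannot exceed their mean size. The bound is kept in
    product form to stay within the natural numbers. *)
Lemma exists_small_fiber (T U : choiceType) (g : T -> U) (A : set T) :
  finite_set A -> A !=set0 ->
  exists2 b, (g @` A) b &
    (#|` fset_set (g @` A)| * #|` fset_set (A `&` g @^-1` [set b])|
      <= #|` fset_set A|)%N.
Proof.
move=> fA [a Aa]; apply: contrapT => nofiber.
have fgA : finite_set (g @` A) by exact: finite_image.
set N := #|` fset_set (g @` A)|.
have N0 : (0 < N)%N.
  rewrite cardfs_gt0; apply/fset0Pn; exists (g a).
  by rewrite in_fset_set// inE; exists a.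
(* If every fiber violated the bound, summing over the [N] attained values would give
   [N * (|A| + 1) <= N * |A|], absurd since [N > 0]. *)
have : (\sum_(b <- fset_set (g @` A)) #|` fset_set A|.+1 <=
  \sum_(b <- fset_set (g @` A)) N * #|` fset_set (A `&` g @^-1` [set b])|)%N.
  rewrite big_seq [leqRHS]big_seq; apply: leq_sum => b.
  rewrite in_fset_set// inE => gAb; rewrite ltnNge; apply/negP => le_b.
  by apply: nofiber; exists b.
rewrite -big_distrr/= card_fibers// big_const_seq count_predT iter_addn_0.
by rewrite mulnC leq_pmul2l// ltnn.
Qed.

Section functional_dependence.
Context (R : realType) (Omega : Type) (T U : choiceType).
Variables (A : Omega -> T) (g : T -> U).

Lemma cond_range_comp b :
  cond_range A (g \o A) b = range A `&` g @^-1` [set b].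
Proof.
apply/seteqP; split=> [_ [w /= <- <-]|_ [[w _ <-] /= <-]].
  by split => //; exists w.
by exists w.
Qed.

Lemma cond_range_compl a : range A a -> cond_range (g \o A) A a = [set g a].
Proof.
move=> [w _ wa]; apply/seteqP; split=> [_ [w' /= <- <-]//|_ ->].
by exists w => //=; rewrite wa.
Qed.

(** Every denominator is the cardinality of a singleton, so the supremum runs over a constant
    family; a point of [Omega] makes that family nonempty, which keeps the supremum from being
    [-oo]. *)
Lemma leakage_comp : [set: Omega] !=set0 ->
  leakage R (g \o A) A = log2 (counting (range (g \o A))).
Proof.
move=> [w _]; rewrite /leakage (_ : [set _ | _ in _] =
    [set log2 (counting (range (g \o A)))]) ?ereal_sup1//.
have E a : range A a -> log2 (counting (range (g \o A)) /
    counting (cond_range (g \o A) A a)) =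
    log2 (counting (range (g \o A))) :> \bar R.
  by move=> Aa; rewrite cond_range_compl// counting_set1 inve1 mule1.
apply/seteqP; split=> [_ [a Aa <-]|_ ->]; first exact: E.
by exists (A w); rewrite ?E.
Qed.

(** Fibers of [g] that share a point coincide, so an overlap chain stays in the fiber where it
    starts and the classes are exactly the fibers. *)
Lemma overlap_partition_comp :
  overlap_partition A (g \o A) = cond_range A (g \o A) @` range (g \o A).
Proof.
have fiberE w : [set a' | range A a' /\ overlap_connected A (g \o A) (A w) a']
    = cond_range A (g \o A) (g (A w)).
  rewrite cond_range_comp; apply/seteqP; split=> a' /=.
    case=> ? [m [b [_ b0 bm bS]]]; split=> //.
    suff bE j : (j <= m)%N -> b j = g (A w).
      by move: bm; rewrite cond_range_comp bE// => -[].
    elim: j => [_|j IH jm]; first by move: b0; rewrite cond_range_comp => -[].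
    have [t] := bS _ jm; rewrite !cond_range_comp => -[[_ /= tj] [_ /= <-]].
    by rewrite tj IH// ltnW.
  (* Conversely, two points of one fiber are joined by the chain with the single index 0. *)
  move=> [Aa' ga']; split => //; exists 0%N, (fun=> g (A w)); split => //.
  - exact: (ex_intro2 _ _ w).
  - by rewrite cond_range_comp.
apply/seteqP; split=> [_ [_ [w _ <-] <-]|_ [_ [w _ <-] <-]].
  by exists (g (A w)); [exists w|rewrite fiberE].
by exists (A w); [exists w|rewrite fiberE].
Qed.

Lemma maximin_information_ge0 (B : Omega -> U) : [set: Omega] !=set0 ->
  0 <= maximin_information R A B.
Proof.
move=> [w _]; apply/log2_ge0/counting_ge1.
by eexists; exists (A w); first by exists w.
Qed.

(** The classes are the image of the range of [g \o A] under the map from a value to its fiber, and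
    an image is no larger than its source. *)
Lemma maximin_information_le_log2 :
  maximin_information R A (g \o A) <= log2 (counting (range (g \o A))).
Proof.
apply: le_log2; first exact: counting_ge0.
by rewrite overlap_partition_comp; exact/card_le_counting/card_image_le.
Qed.

(* When [g \o A] has finite range, definedness of the leakage makes [range A]
   a finite union of finite fibers, so that averaging over the fibers yields
   one of size at most |[[A]]| / |[[g \o A]]|. *)
Lemma log2_le_leakage_comp : [set: Omega] !=set0 ->
  finite_set (range (g \o A)) -> leakage_defined A (g \o A) ->
  log2 (counting (range (g \o A))) <= leakage R A (g \o A).
Proof.
move=> [w _] fgA defA.
have fA : finite_set (range A).
  rewrite (_ : range A =
    \bigcup_(b in range (g \o A)) cond_range A (g \o A) b); last first.
    apply/seteqP; split=> [_ [w' _ <-]|_ [b _ [w' _ <-]]]; last by exists w'.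
    by exists (g (A w')); [exists w'|exists w'].
  apply: bigcup_finite => // b /defA [fA|//].
  by apply: sub_finite_set fA => _ [w' _ <-]; exists w'.
have [|b] := exists_small_fiber g fA; first by exists (A w), w.
rewrite image_comp -cond_range_comp => gAb le_b.
apply: le_trans (ereal_sup_ubound _); last by exists b.
apply: le_log2; first exact: counting_ge0.
have fb : finite_set (cond_range A (g \o A) b).
  by apply: sub_finite_set fA => _ [w' _ <-]; exists w'.
(* The value [b] is attained, so its fiber has positive size; the extended inverse is then the real
   one and the ratio bound becomes the product bound [le_b]. *)
have : 1 <= counting (cond_range A (g \o A) b) :> \bar R.
  by apply: counting_ge1; case: gAb => w' _ <-; exists (A w'), w'.
rewrite !counting_finite// lee_fin => b1.
have b0 := lt_le_trans (ltr01 : (0 < 1 :> R)%R) b1.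
rewrite inver gt_eqF// -EFinM lee_fin ler_pdivlMr//.
by rewrite -natrM ler_nat.
Qed.

End functional_dependence.

(** By compatibility, the vector produced by [psi i v] is itself [X w'] for some outcome [w'], and
    deleting its entry [i] gives back [v]. *)
Lemma range_psi_sub (R : realType) (Omega T : Type) (n : nat)
    (X : Omega -> 'rV[R]_n) (h : 'rV[R]_n -> T) (i : 'I_n) (v : 'rV[R]_n.-1) :
  psi_compatible X i -> range (others X i) v ->
  range (h \o psi i v \o X) `<=` cond_range (h \o X) (others X i) v.
Proof.
move=> hpsi hv _ [w _ <-].
have [||w' _ Xw'] := hpsi (X w ord0 i) v; [by exists w|by []|].
exists w'; last by rewrite /= Xw'.
apply/rowP => k; rewrite /others Xw' !mxE.
by rewrite liftK.
Qed.

Theorem theorem1 (R : realType) (Omega : Type) (n q : nat)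
    (X : Omega -> 'rV[R]_n) (f : 'rV[R]_n -> 'rV[R]_q)
    (M : 'rV[R]_q -> 'rV[R]_q) (eps : R) (i : 'I_n) (v : 'rV[R]_n.-1)
    (hOmega : [set: Omega] !=set0)
    (hX : discrete X)
    (heps : (0 < eps)%R)
    (hpriv : noiselessly_private X (M \o f) eps)
    (hpsi : psi_compatible X i)
    (hv : range (others X i) v) :
  let Y := M \o f \o psi i v \o X in
  let Xi := data X i in
  (leakage_defined Xi Y ->
    [/\ 0 <= maximin_information R Xi Y,
        maximin_information R Xi Y <= sym_leakage R Xi Y,
        sym_leakage R Xi Y <= leakage R Y Xi &
        leakage R Y Xi <= eps%:E]) /\
  [/\ leakage_defined Y Xi,
      0 <= maximin_information R Xi Y,
      maximin_information R Xi Y <= leakage R Y Xi &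
      leakage R Y Xi <= eps%:E].
Proof.
move=> Y Xi.
(* Since [psi i v] retains only the entry [i] of its argument, [Y] is convertible to [g \o Xi], and
   the lemmas on functional dependence apply directly. *)
pose g a := M (f (insert_entry i a v)).
have cY : counting (range Y) <= (2 `^ eps)%:E :> \bar R.
  apply: le_trans (hpriv i v hv); apply/card_le_counting/subset_card_le.
  exact: (range_psi_sub (h := M \o f)).
have fY : finite_set (range Y) := counting_lty_finite (le_lt_trans cY (ltry _)).
have LE : leakage R Y Xi = log2 (counting (range Y)).
  exact: (leakage_comp R Xi g).
have Leps : leakage R Y Xi <= eps%:E.
  by rewrite LE -log2_powR; apply: le_log2 => //; exact: counting_ge0.
have I0 : 0 <= maximin_information R Xi Y by exact: maximin_information_ge0.
have IL : maximin_information R Xi Y <= leakage R Y Xi.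
  by rewrite LE; exact: (maximin_information_le_log2 R Xi g).
(* Finiteness of the range of [Y], forced by the privacy bound, already gives
   [leakage_defined Y Xi]. *)
split=> [def|]; last by split => // b _; left.
split => //; last by rewrite /sym_leakage ge_min lexx orbT.
(* Of the two bounds behind the minimum, one is [IL]; the other passes through [log2] of the size of
   the range of [Y]. *)
rewrite /sym_leakage le_min IL andbT.
rewrite (le_trans IL)// LE; exact: (@log2_le_leakage_comp R _ _ _ Xi g).
Qed.
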